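(* Assume the setting below, with $\kappa_f(x,i)=K_ix$ where the gains $K_i$ are such that the Markov jump linear system $z_{k+1}=\Gamma_{\theta_k}z_k$, $\Gamma_i=A_i+B_iK_i$, is mean square stable, and assume $\hat f_\theta$ is $\beta_f^\theta$-smooth and $\bar\ell(\cdot,\theta)$ is $\beta_\ell^\theta$-smooth for every $\theta$, and the pairs $\{(A_i,B_i)\}_{i\in\mathcal{N}}$ are mean square stabilizable. Then there exist $\delta>0$ and $\alpha>0$ such that the terminal cost $V_f$ constructed below with this $\alpha$ satisfies $$\mathcal{L}V_f(x,\theta):=\mathbb{E}[V_f(\hat f_\theta(x),\theta_{k+1})-V_f(x,\theta)\mid\theta_k=\theta]\le-\bar\ell(x,\theta)\quad\text{for all }x\in\mathcal{B}_\delta,\ \theta\in\mathcal{N}.$$ If, in addition, $X^f=\{X^f_i\}$ is uniformly positive invariant for the constrained system in closed loop with $\kappa_f$, with $X^f_i\subseteq\mathcal{B}_\delta$ for all $i$, and the strict stochastic dissipativity assumption holds with $\rho(x,i)\ge\gamma\|x-x_s\|^2$ for some $\gamma>0$, then the system controlled by the terminal-set EMPC law $\hat\kappa_N$ (with terminal penalty $V_f$ and terminal sets $X^f$) is locally mean square stable.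
   Context: Setting: $\mathcal{N}=\{1,\dots,\nu\}$; $\{\theta_k\}$ a time-homogeneous, irreducible, aperiodic Markov chain on $\mathcal{N}$ with transition matrix $P=(p_{ij})$, $\mathcal{C}(i)=\{j:p_{ij}>0\}$, on a filtered probability space with $\mathfrak{F}_k$ generated by the history up to time $k$; system $x_{k+1}=f(x_k,u_k,\theta_k)$ with constraints $(x_k,u_k)\in Y_{\theta_k}$ ($Y_\theta$ nonempty compact), stage cost $\ell$ (each $\ell(\cdot,\cdot,\theta)$ nonnegative, lower semicontinuous, level-bounded in $u$ locally uniformly in $x$), $f(\cdot,\cdot,\theta)$ continuous; $x_k,\theta_k$ measured at time $k$. There is a common optimal steady state $(x_s,u_s)=(0,0)$ for all modes with optimal steady-state cost $\ell_s$. $\mathcal{B}_\delta=\{x:\|x\|<\delta\}$. A function is $\beta$-smooth if differentiable with $\beta$-Lipschitz gradient (Jacobian). Define $\hat f_\theta(x)=f(x,K_\theta x,\theta)$, $\bar\ell(x,\theta)=\ell(x,K_\theta x,\theta)-\ell(0,0,\theta)$, $A_i=\frac{\partial f}{\partial x}(0,0,i)$, $B_i=\frac{\partial f}{\partial u}(0,0,i)$. For $\alpha>0$, $\ell_q(x,\theta)=\tfrac12(\alpha+\beta_\ell^\theta)\|x\|^2+\nabla\bar\ell(0,\theta)^\top x$, and $V_f(x,i)=\mathbb{E}[\sum_{k=0}^\infty\ell_q(x_k,\theta_k)\mid x_0=x,\theta_0=i]$ along $x_{k+1}=\Gamma_{\theta_k}x_k$. Strict stochastic dissipativity: there are $\lambda:\mathbb{R}^n\times\mathcal{N}\to\mathbb{R}$,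 lower semicontinuous in the first argument, with $\lambda(x_s,\theta)=\lambda_s$ independent of $\theta$, and convex $\rho:\mathbb{R}^n\times\mathcal{N}\to\mathbb{R}_+$ positive definite w.r.t. $x_s$, with $\mathbb{E}[\lambda(x_{k+1},\theta_{k+1})-\lambda(x_k,\theta_k)\mid\mathfrak{F}_k]\le\ell(x_k,u_k,\theta_k)-\ell_s-\rho(x_k,\theta_k)$ for all states, inputs and modes. UPI: $\{C_i\}$ is UPI for a constrained closed-loop system if $x_k\in C_{\theta_k}$ implies $x_{k+1}\in C_{\theta_{k+1}}$, constraints satisfied. Terminal-set EMPC: $\hat\kappa_N(x,\theta)$ is the first element of an optimal policy of minimizing $\mathbb{E}[V_f(x_N,\theta_N)+\sum_{j=0}^{N-1}\ell(x_j,u_j,\theta_j)\mid\mathfrak{F}_0]$ subject to $x_{k+1}=f(x_k,u_k,\theta_k)$, $(x_k,u_k)\in Y_{\theta_k}$, $(x_0,\theta_0)=(x,\theta)$, $x_N\in X^f_{\theta_N}$, $u_k$ $\mathfrak{F}_k$-measurable. Mean square stability means $\mathbb{E}\|x_k\|^2\to0$ as $k\to\infty$.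
   Formalization: The formal statement assumes each f(·,·,i) is jointly differentiable at (0,0), with A_i and B_i its partial Jacobians; existence of the partial derivatives alone would not make Γ_i the Jacobian of f̂_i at 0, and the decrease claim could then fail. *)

(* Defs.v *)
From HB Require Import structures.
From mathcomp Require Import all_boot all_order all_algebra.
From mathcomp Require Import all_classical all_reals all_analysis.
Import Order.TTheory GRing.Theory Num.Theory.
Import numFieldNormedType.Exports.
Set Implicit Arguments. Unset Strict Implicit. Unset Printing Implicit Defensive.
Local Open Scope ring_scope.
Local Open Scope classical_set_scope.

Section Defs.
Context {R : realType}.

Definition enorm {k : nat} (x : 'cV[R]_k) : R := Num.sqrt (\sum_i x i 0 ^+ 2).

Definition stochastic {nu : nat} (P : 'M[R]_nu) : Prop :=
  (forall i j, 0 <= P i j) /\ (forall i, \sum_j P i j = 1).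

Definition irreducible {nu : nat} (P : 'M[R]_nu) : Prop :=
  forall i j, exists k, (0 < k)%N /\ 0 < (P ^+ k) i j.

(** every state has period 1: the gcd of the return times is 1, i.e. no
    d > 1 divides all return times *)
Definition aperiodic {nu : nat} (P : 'M[R]_nu) : Prop :=
  forall i d, (1 < d)%N -> exists k, [/\ (0 < k)%N, 0 < (P ^+ k) i i & ~~ (d %| k)%N].

Definition stationary {nu : nat} (P : 'M[R]_nu) (pi : 'I_nu -> R) : Prop :=
  [/\ forall i, 0 <= pi i, \sum_i pi i = 1 & forall j, \sum_i pi i * P i j = pi j].

(** probability of theta_1 .. theta_k = t given theta_0 = i *)
Fixpoint hprob {nu : nat} (P : 'M[R]_nu) (i : 'I_nu) (t : seq 'I_nu) : R :=
  match t with
  | [::] => 1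
  | j :: t' => P i j * hprob P j t'
  end.

Fixpoint run {n nu : nat} (g : 'cV[R]_n -> 'I_nu -> 'cV[R]_n) (x : 'cV[R]_n)
  (h : seq 'I_nu) : 'cV[R]_n :=
  match h with
  | [::] => x
  | th :: h' => run g (g x th) h'
  end.

(** E[ F(x_k, theta_k) | x_0 = x, theta_0 = i ] for x_{k+1} = g x_k theta_k ;
    the history theta_0..theta_k is i :: t with t a k-tuple *)
Definition Eauto {n nu : nat} (P : 'M[R]_nu) (g : 'cV[R]_n -> 'I_nu -> 'cV[R]_n)
  (F : 'cV[R]_n -> 'I_nu -> R) (x : 'cV[R]_n) (i : 'I_nu) (k : nat) : R :=
  \sum_(t : k.-tuple 'I_nu) hprob P i t * F (run g x (belast i t)) (last i t).

Definition msq {n nu : nat} (P : 'M[R]_nu) (g : 'cV[R]_n -> 'I_nu -> 'cV[R]_n)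
  (x : 'cV[R]_n) (i : 'I_nu) (k : nat) : R :=
  Eauto P g (fun z _ => enorm z ^+ 2) x i k.

Definition ms_conv {n nu : nat} (P : 'M[R]_nu) (g : 'cV[R]_n -> 'I_nu -> 'cV[R]_n)
  (x : 'cV[R]_n) (i : 'I_nu) : Prop :=
  (fun k => msq P g x i k) @ \oo --> (0 : R).

Definition mjls {n nu : nat} (G : 'I_nu -> 'M[R]_n) : 'cV[R]_n -> 'I_nu -> 'cV[R]_n :=
  fun z i => G i *m z.

Definition mjls_ms_stable {n nu : nat} (P : 'M[R]_nu) (G : 'I_nu -> 'M[R]_n) : Prop :=
  forall x i, ms_conv P (mjls G) x i.

Definition ms_stabilizable {n m nu : nat} (P : 'M[R]_nu) (A : 'I_nu -> 'M[R]_n)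
  (B : 'I_nu -> 'M[R]_(n, m)) : Prop :=
  exists F : 'I_nu -> 'M[R]_(m, n), mjls_ms_stable P (fun i => A i + B i *m F i).

Definition lsc {T : topologicalType} (h : T -> R) : Prop :=
  forall p (e : R), 0 < e -> \forall q \near p, h p - e < h q.

Definition convex_fun {n : nat} (h : 'cV[R]_n -> R) : Prop :=
  forall x y (t : R), 0 <= t <= 1 ->
    h (t *: x + (1 - t) *: y) <= t * h x + (1 - t) * h y.

(** level-bounded in u locally uniformly in x (Rockafellar--Wets) *)
Definition level_bounded_loc {n m : nat} (h : 'cV[R]_n -> 'cV[R]_m -> R) : Prop :=
  forall (xb : 'cV[R]_n) (a : R), exists (e M : R), 0 < e /\
    forall x u, enorm (x - xb) < e -> h x u <= a -> enorm u <= M.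

(** beta-smooth vector map: differentiable with beta-Lipschitz Jacobian
    (Jacobians compared in the operator norm induced by the Euclidean norm) *)
Definition smooth_map {n : nat} (beta : R) (g : 'cV[R]_n -> 'cV[R]_n) : Prop :=
  (forall x, differentiable g x) /\
  forall x y v, enorm ('d g x v - 'd g y v) <= beta * enorm (x - y) * enorm v.

(** beta-smooth scalar function: differentiable with beta-Lipschitz gradient
    (Euclidean norm); |(grad g x - grad g y)^T v| <= beta |x-y| |v| for all v *)
Definition smooth_fun {n : nat} (beta : R) (g : 'cV[R]_n -> R) : Prop :=
  (forall x, differentiable g x) /\
  forall x y v, `|'d g x v - 'd g y v| <= beta * enorm (x - y) * enorm v.

(** l_q(x, theta) = 1/2 (alpha + beta_l^theta) |x|^2 + grad lbar(0,theta)^T x,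
    where grad^T x is given by the differential dl0 theta *)
Definition lq {n nu : nat} (alpha : R) (betal : 'I_nu -> R)
  (dl0 : 'I_nu -> 'cV[R]_n -> R) (x : 'cV[R]_n) (th : 'I_nu) : R :=
  2^-1 * (alpha + betal th) * enorm x ^+ 2 + dl0 th x.

Definition Vf {n nu : nat} (P : 'M[R]_nu) (Gamma : 'I_nu -> 'M[R]_n) (alpha : R)
  (betal : 'I_nu -> R) (dl0 : 'I_nu -> 'cV[R]_n -> R) (x : 'cV[R]_n) (i : 'I_nu) : R :=
  limn (series (fun k => Eauto P (mjls Gamma) (lq alpha betal dl0) x i k)).

(** A policy assigns the input u_k to every history theta_0..theta_k (the state
    history is a deterministic function of it, x_0 being fixed), i.e. u_k is
    F_k-measurable. pstate gives the state after the modes h, pre being the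
    history already visited. *)
Fixpoint pstate {n m nu : nat} (f : 'cV[R]_n -> 'cV[R]_m -> 'I_nu -> 'cV[R]_n)
  (mu : seq 'I_nu -> 'cV[R]_m) (x : 'cV[R]_n) (pre h : seq 'I_nu) : 'cV[R]_n :=
  match h with
  | [::] => x
  | th :: h' => pstate f mu (f x (mu (rcons pre th)) th) (rcons pre th) h'
  end.

Definition xat {n m nu : nat} f (mu : seq 'I_nu -> 'cV[R]_m) (x : 'cV[R]_n)
  (hist : seq 'I_nu) (j : nat) : 'cV[R]_n :=
  @pstate n m nu f mu x [::] (take j hist).

Definition ocp_cost {n m nu : nat} (N : nat) (P : 'M[R]_nu)
  (f : 'cV[R]_n -> 'cV[R]_m -> 'I_nu -> 'cV[R]_n) (ell : 'cV[R]_n -> 'cV[R]_m -> 'I_nu -> R)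
  (V : 'cV[R]_n -> 'I_nu -> R) (mu : seq 'I_nu -> 'cV[R]_m) (x : 'cV[R]_n) (i : 'I_nu) : R :=
  \sum_(t : N.-tuple 'I_nu) hprob P i t *
    (V (xat f mu x (i :: t) N) (last i t) +
     \sum_(j < N) ell (xat f mu x (i :: t) j) (mu (take j.+1 (i :: t))) (nth i (i :: t) j)).

(** almost sure constraint satisfaction (on all histories of positive probability) *)
Definition ocp_admissible {n m nu : nat} (N : nat) (P : 'M[R]_nu)
  (f : 'cV[R]_n -> 'cV[R]_m -> 'I_nu -> 'cV[R]_n) (Y : 'I_nu -> set ('cV[R]_n * 'cV[R]_m))
  (Xf : 'I_nu -> set 'cV[R]_n) (mu : seq 'I_nu -> 'cV[R]_m) (x : 'cV[R]_n) (i : 'I_nu) : Prop :=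
  forall t : N.-tuple 'I_nu, 0 < hprob P i t ->
    (forall j, (j < N)%N ->
       Y (nth i (i :: t) j) (xat f mu x (i :: t) j, mu (take j.+1 (i :: t)))) /\
    Xf (last i t) (xat f mu x (i :: t) N).

Definition ocp_feasible {n m nu : nat} N P f Y Xf (x : 'cV[R]_n) (i : 'I_nu) : Prop :=
  exists mu : seq 'I_nu -> 'cV[R]_m, @ocp_admissible n m nu N P f Y Xf mu x i.

Definition empc_law {n m nu : nat} N P f ell Y Xf V
  (kappa : 'cV[R]_n -> 'I_nu -> 'cV[R]_m) : Prop :=
  forall x i, @ocp_feasible n m nu N P f Y Xf x i ->
    exists mu, [/\ ocp_admissible N P f Y Xf mu x i,
      (forall mu', ocp_admissible N P f Y Xf mu' x i ->
         ocp_cost N P f ell V mu x i <= ocp_cost N P f ell V mu' x i)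
      & mu [:: i] = kappa x i].

Definition UPI {n m nu : nat} (P : 'M[R]_nu) (f : 'cV[R]_n -> 'cV[R]_m -> 'I_nu -> 'cV[R]_n)
  (K : 'I_nu -> 'M[R]_(m, n)) (Y : 'I_nu -> set ('cV[R]_n * 'cV[R]_m))
  (C : 'I_nu -> set 'cV[R]_n) : Prop :=
  forall i x, C i x -> Y i (x, K i *m x) /\
    forall j, 0 < P i j -> C j (f x (K i *m x) i).

End Defs.

(* Main.v *)
Require Import Defs.
From HB Require Import structures.
From mathcomp Require Import all_boot all_order all_algebra.
From mathcomp Require Import all_classical all_reals all_analysis.
From mathcomp Require Import ring lra.
Import Order.TTheory GRing.Theory Num.Theory.
Import numFieldNormedType.Exports.
Local Open Scope ring_scope.
Local Open Scope classical_set_scope.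

Set Implicit Arguments.
Unset Strict Implicit.
Unset Printing Implicit Defensive.

(** Mean square stability of the linearization is uniform in the initial state
    (it can be tested on a basis), so [E |z_k|] and [E |z_k|^2] are summable with
    sums bounded by multiples of [|x|] and [|x|^2].  Hence [Vf] is a quadratic
    plus a linear form solving [Vf x i = lq x i + sum_j P i j * Vf (Gamma_i x) j],
    and replacing [Gamma_i x] by [fhat i x] costs at most [alpha/2 |x|^2] near 0
    once [alpha] is large; the smoothness of [lbar] absorbs the rest.

    For the closed loop, dissipativity at the steady state forces
    [ell 0 0 i = ell_s] for every mode.  Extending an optimal policy by the
    terminal controller shows that the optimal value decreases in mean by
    [ell - ell_s]; adding the storage function [lam] gives a Lyapunov function,
    bounded below because the constraint sets are compact, that decreases by at
    least [gamma |x|^2].  So [E |x_k|^2] is summable. *)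

(** * Expectations along a Markov chain *)

Section Expectation.
Context {R : realType} {nu : nat}.
Implicit Types P : 'M[R]_nu.

Lemma sum_tuple0 (T : finType) (F : 0.-tuple T -> R) :
  \sum_(t : 0.-tuple T) F t = F [tuple].
Proof.
rewrite (bigD1 [tuple]) //= big1 ?addr0 // => t.
by rewrite (tuple0 t) => /eqP.
Qed.

Lemma sum_tupleS (T : finType) k (F : seq T -> R) :
  \sum_(t : k.+1.-tuple T) F t = \sum_j \sum_(t : k.-tuple T) F (j :: t).
Proof.
rewrite pair_big /=.
rewrite (reindex (fun p : T * k.-tuple T => cons_tuple p.1 p.2)) //=.
exists (fun t : k.+1.-tuple T => (thead t, behead_tuple t)) => /= [[j t] _|t _].
  by congr pair; apply: val_inj.
by case/tupleP: t => j t; apply: val_inj.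
Qed.

Lemma hprob_ge0 P : stochastic P -> forall t i, 0 <= hprob P i t.
Proof.
case=> P0 _; elim=> [|j t IH] i //=; exact: mulr_ge0.
Qed.

Lemma sum_hprob P : stochastic P ->
  forall k i, \sum_(t : k.-tuple 'I_nu) hprob P i t = 1.
Proof.
move=> [P0 P1]; elim=> [|k IH] i; first by rewrite sum_tuple0.
rewrite sum_tupleS /=; under eq_bigr => j _ do rewrite -mulr_sumr IH mulr1.
exact: P1.
Qed.

Lemma hprob_pos P : stochastic P ->
  forall k i, exists t : k.-tuple 'I_nu, 0 < hprob P i t.
Proof.
move=> sP k i; apply: contrapT => /forallNP H.
have := sum_hprob sP k i; rewrite big1 => [/esym/eqP|t _]; first by rewrite oner_eq0.
by apply/eqP; rewrite eq_le (hprob_ge0 sP) andbT leNgt; apply/negP/H.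
Qed.

(** Only successors of positive probability are compared, because invariance and feasibility are
    known only there. *)
Lemma mean_le P i (F G : 'I_nu -> R) : stochastic P ->
  (forall j, 0 < P i j -> F j <= G j) ->
  \sum_j P i j * F j <= \sum_j P i j * G j.
Proof.
move=> [P0 _] FG; apply: ler_sum => j _.
have := P0 i j; rewrite le_eqVlt => /predU1P[<-|Pij]; first by rewrite !mul0r.
by rewrite ler_pM2l// FG.
Qed.

Lemma mean_cst P i (c : R) : stochastic P -> \sum_j P i j * c = c.
Proof. by case=> _ P1; rewrite -mulr_suml P1 mul1r. Qed.

End Expectation.

Section Eauto.
Context {R : realType} {n nu : nat} (P : 'M[R]_nu)
  (g : 'cV[R]_n -> 'I_nu -> 'cV[R]_n).
Hypothesis sP : stochastic P.
Implicit Types (F G : 'cV[R]_n -> 'I_nu -> R) (x y : 'cV[R]_n).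

Lemma Eauto0 F x i : Eauto P g F x i 0 = F x i.
Proof. by rewrite /Eauto sum_tuple0 /= mul1r. Qed.

Lemma EautoS F x i k :
  Eauto P g F x i k.+1 = \sum_j P i j * Eauto P g F (g x i) j k.
Proof.
rewrite /Eauto.
rewrite (sum_tupleS k (fun t : seq _ => hprob P i t * F (run g x (belast i t)) (last i t))).
by apply: eq_bigr => j _; rewrite mulr_sumr; apply: eq_bigr => t _ /=; rewrite mulrA.
Qed.

Lemma Eauto_Markov F x i k l :
  Eauto P g F x i (k + l) = Eauto P g (fun y j => Eauto P g F y j l) x i k.
Proof.
elim: k x i => [|k IH] x i; first by rewrite Eauto0.
by rewrite addSn !EautoS; apply: eq_bigr => j _; rewrite IH.
Qed.

Lemma ler_Eauto F G x i k : (forall y j, F y j <= G y j) ->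
  Eauto P g F x i k <= Eauto P g G x i k.
Proof.
move=> FG; apply: ler_sum => t _; apply: ler_wpM2l => //; exact: hprob_ge0.
Qed.

Lemma Eauto_ge0 F x i k : (forall y j, 0 <= F y j) -> 0 <= Eauto P g F x i k.
Proof.
by move=> F0; apply: sumr_ge0 => t _; apply: mulr_ge0 => //; exact: hprob_ge0.
Qed.

Lemma EautoD F G x i k :
  Eauto P g (fun y j => F y j + G y j) x i k = Eauto P g F x i k + Eauto P g G x i k.
Proof. by rewrite /Eauto -big_split /=; apply: eq_bigr => t _; rewrite mulrDr. Qed.

Lemma EautoZ c F x i k :
  Eauto P g (fun y j => c * F y j) x i k = c * Eauto P g F x i k.
Proof. by rewrite /Eauto mulr_sumr; apply: eq_bigr => t _; rewrite mulrCA. Qed.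

Lemma Eauto_cst c x i k : Eauto P g (fun _ _ => c) x i k = c.
Proof. by rewrite /Eauto -mulr_suml sum_hprob// mul1r. Qed.

Lemma ler_norm_Eauto F x i k :
  `|Eauto P g F x i k| <= Eauto P g (fun y j => `|F y j|) x i k.
Proof.
apply: le_trans (ler_norm_sum _ _ _) _; apply: ler_sum => t _.
by rewrite normrM ger0_norm // hprob_ge0.
Qed.

(* Foster's criterion: the drift inequality telescopes. *)
Lemma sum_Eauto_le_drift (D : 'cV[R]_n -> 'I_nu -> Prop) F W M :
  (forall x i, D x i -> forall j, 0 < P i j -> D (g x i) j) ->
  (forall x i, D x i -> 0 <= W x i + M) ->
  (forall x i, D x i -> \sum_j P i j * W (g x i) j <= W x i - F x i) ->
  forall T x i, D x i -> \sum_(k < T) Eauto P g F x i k <= W x i + M.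
Proof.
move=> Dg Wge drift; elim=> [|T IH] x i Dx; first by rewrite big_ord0 Wge.
rewrite big_ord_recl Eauto0; under eq_bigr => k _ do rewrite /bump /= EautoS.
rewrite exchange_big /=; under eq_bigr => j _ do rewrite -mulr_sumr.
have : \sum_j P i j * (\sum_(k < T) Eauto P g F (g x i) j k)
       <= \sum_j P i j * (W (g x i) j + M).
  by apply: mean_le => // j Pij; apply: IH; exact: Dg.
under [X in _ <= X]eq_bigr => j _ do rewrite mulrDr.
rewrite big_split /= mean_cst //; have := drift _ _ Dx; lra.
Qed.

End Eauto.

(** * Series with bounded partial sums *)

Section Series.
Context {R : realType}.

Lemma bounded_series_cvg (u : R^nat) (M : R) : (forall k, 0 <= u k) ->
  (forall T, \sum_(k < T) u k <= M) -> cvgn (series u).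
Proof.
move=> u0 uM; apply: nondecreasing_is_cvgn; first exact: nondecreasing_series.
by exists M => _ [T _ <-]; rewrite /series /= big_mkord.
Qed.

Lemma bounded_abs_series_cvg (u : R^nat) (M : R) :
  (forall T, \sum_(k < T) `|u k| <= M) -> cvgn (series u).
Proof.
move=> uM; apply: normed_cvg.
exact: (@bounded_series_cvg (fun k => `|u k|) M).
Qed.

Lemma norm_limn_series_le (u : R^nat) (M : R) :
  (forall T, \sum_(k < T) `|u k| <= M) -> `|limn (series u)| <= M.
Proof.
move=> uM; have cu := bounded_abs_series_cvg uM.
have /is_cvg_norm nu := cu.
rewrite -lim_norm //; apply: limr_le => //; apply: nearW => T.
by apply: le_trans (uM T); rewrite /series /= big_mkord; exact: ler_norm_sum.
Qed.

End Series.

(** * Norms and Taylor bounds on column vectors *)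

Section Norms.
Context {R : realType}.

Lemma Cauchy_Schwarz_sum (I : finType) (a b : I -> R) :
  (\sum_i a i * b i) ^+ 2 <= (\sum_i a i ^+ 2) * (\sum_i b i ^+ 2).
Proof.
(* Lagrange's argument: after doubling and symmetrising, the difference of the two sides is the sum
   of the squares of [a i * b j - a j * b i]. *)
rewrite expr2 !big_distrlr /= -(ler_pM2l (ltr0n R 2)) mulr_sumr.
have -> : 2%:R * (\sum_i \sum_j a i ^+ 2 * b j ^+ 2) =
    \sum_i \sum_j (a i ^+ 2 * b j ^+ 2 + a j ^+ 2 * b i ^+ 2).
  under [RHS]eq_bigr => i _ do rewrite big_split /=.
  by rewrite big_split /= [X in _ = _ + X]exchange_big /= mulr_natl mulr2n.
apply: ler_sum => i _; rewrite mulr_sumr; apply: ler_sum => j _.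
by have := sqr_ge0 (a i * b j - a j * b i); nra.
Qed.

Lemma enorm_ge0 k (x : 'cV[R]_k) : 0 <= enorm x.
Proof. exact: sqrtr_ge0. Qed.

Lemma sqr_enorm k (x : 'cV[R]_k) : enorm x ^+ 2 = \sum_i x i 0 ^+ 2.
Proof. by rewrite sqr_sqrtr // sumr_ge0 // => i _; exact: sqr_ge0. Qed.

Lemma enormZ k c (x : 'cV[R]_k) : enorm (c *: x) = `|c| * enorm x.
Proof.
rewrite /enorm; under eq_bigr => i _ do rewrite mxE exprMn.
by rewrite -mulr_sumr sqrtrM ?sqr_ge0 // sqrtr_sqr.
Qed.

Lemma coord_le_enorm k (x : 'cV[R]_k) i : `|x i 0| <= enorm x.
Proof.
rewrite -(sqrtr_sqr (x i 0)) ler_sqrt ?sumr_ge0 // => [|j _]; last exact: sqr_ge0.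
rewrite (bigD1 i) //= lerDl sumr_ge0 // => j _; exact: sqr_ge0.
Qed.

Lemma mx_norm_le_coord k (x : 'cV[R]_k) (c : R) : 0 <= c ->
  (forall i, `|x i 0| <= c) -> `|x| <= c.
Proof.
move=> c0 xc; rewrite [leLHS]/Num.Def.normr/= mx_normrE (bigmax_le _ c0)//= => -[i j] _.
by rewrite (ord1 j) xc.
Qed.

Lemma coord_le_mx_norm k (x : 'cV[R]_k) i : `|x i 0| <= `|x|.
Proof.
rewrite [leRHS]/Num.Def.normr/= mx_normrE.
exact: (le_bigmax _ (fun ij => `|x ij.1 ij.2|) (i, 0)).
Qed.

(** Terms linear in the state are measured by the sup norm [|x|], quadratic ones by [enorm]; this
    links the two. *)
Lemma mx_norm_le_enorm k (x : 'cV[R]_k) : `|x| <= enorm x.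
Proof. by apply: mx_norm_le_coord => [|i]; [exact: enorm_ge0|exact: coord_le_enorm]. Qed.

Lemma cV_sum_delta k (x : 'cV[R]_k) : x = \sum_a x a 0 *: delta_mx a 0.
Proof.
rewrite [LHS]matrix_sum_delta; apply: eq_bigr => a _.
by rewrite big_ord1.
Qed.

Lemma sqr_enorm_sum_le k l (c : 'cV[R]_k) (Z : 'I_k -> 'cV[R]_l) :
  enorm (\sum_a c a 0 *: Z a) ^+ 2 <= enorm c ^+ 2 * \sum_a enorm (Z a) ^+ 2.
Proof.
rewrite !sqr_enorm; under [X in _ <= _ * X]eq_bigr => a _ do rewrite sqr_enorm.
rewrite exchange_big mulr_sumr /=; apply: ler_sum => b _.
rewrite summxE; under [X in X ^+ 2 <= _]eq_bigr => a _ do rewrite mxE.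
exact: Cauchy_Schwarz_sum.
Qed.

Lemma mx_norm_sum_le k l (c : 'cV[R]_k) (Z : 'I_k -> 'cV[R]_l) :
  `|\sum_a c a 0 *: Z a| <= `|c| * \sum_a `|Z a|.
Proof.
apply: le_trans (ler_norm_sum _ _ _) _; rewrite mulr_sumr.
by apply: ler_sum => a _; rewrite normrZ ler_wpM2r // coord_le_mx_norm.
Qed.

Lemma sqr_enorm_mulmx_le k l (M : 'M[R]_(l, k)) (x : 'cV[R]_k) :
  enorm (M *m x) ^+ 2 <= enorm x ^+ 2 * \sum_a enorm (col a M) ^+ 2.
Proof.
rewrite {1}(cV_sum_delta x) mulmx_sumr.
under eq_bigr => a _ do rewrite -scalemxAr -colE.
exact: sqr_enorm_sum_le.
Qed.

Lemma linear_le_mx_norm k (L : {linear 'cV[R]_k -> R}) x :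
  `|L x| <= (\sum_a `|L (delta_mx a 0)|) * `|x|.
Proof.
rewrite {1}(cV_sum_delta x) linear_sum; apply: le_trans (ler_norm_sum _ _ _) _.
rewrite mulr_suml; apply: ler_sum => a _.
by rewrite linearZ /= normrM mulrC ler_wpM2l // coord_le_mx_norm.
Qed.

(* Young's inequality on the cross term *)
Lemma sqr_enormD_dist k (a b : 'cV[R]_k) (s : R) : 0 < s ->
  `|enorm (a + b) ^+ 2 - enorm a ^+ 2| <=
  s * enorm a ^+ 2 + (1 + s^-1) * enorm b ^+ 2.
Proof.
move=> s0; rewrite !sqr_enorm -sumrB; apply: le_trans (ler_norm_sum _ _ _) _.
rewrite !mulr_sumr -big_split /=; apply: ler_sum => i _; rewrite mxE.
set u := a i 0; set v := b i 0.
have -> : (u + v) ^+ 2 - u ^+ 2 = 2 * (u * v) + v ^+ 2 by ring.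
have h : 0 < s^-1 by rewrite invr_gt0.
have e1 : 0 <= s * u ^+ 2 + s^-1 * v ^+ 2 - 2 * (u * v).
  rewrite (_ : _ - _ = s * (u - s^-1 * v) ^+ 2); last by field; lra.
  by rewrite mulr_ge0 ?sqr_ge0 ?ltW.
have e2 : 0 <= s * u ^+ 2 + s^-1 * v ^+ 2 + 2 * (u * v).
  rewrite (_ : _ + _ = s * (u + s^-1 * v) ^+ 2); last by field; lra.
  by rewrite mulr_ge0 ?sqr_ge0 ?ltW.
have e3 := sqr_ge0 v.
by rewrite ler_norml; apply/andP; split; lra.
Qed.

End Norms.

Section Taylor.
Context {R : realType} {n : nat}.

(** Along the segment, [h (t *: x)] minus the primitive [c * t + b / 2 * t ^+ 2] has nonpositive
    derivative on [0, 1], hence does not increase from 0 to 1. *)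
Lemma Taylor_upper (h : 'cV[R]_n -> R) (b c : R) (x : 'cV[R]_n) :
  (forall z, differentiable h z) ->
  (forall t, 0 <= t <= 1 -> 'd h (t *: x) x <= c + b * t) ->
  h x - h 0 <= c + b / 2.
Proof.
move=> dh hb.
pose l (t : R) := t *: x.
have dl (t : R) : is_diff t l l by exact: is_diff_scalel.
pose q (t : R) := c * t + b / 2 * t ^+ 2.
have dq (t : R) : is_derive t 1 q (c + b * t).
  apply: is_derive_eq.
  by rewrite /GRing.scale /=; field.
pose phi (t : R) : R := h (l t) - q t.
have dphi (t : R) : is_derive t 1 phi ('d h (t *: x) x - (c + b * t)).
  apply: is_deriveB.
  have dhl : differentiable (h \o l) t by apply: differentiable_comp.
  apply: DeriveDef; first exact/derivable1_diffP.
  by rewrite deriveE // diff_comp //= (@diff_val _ _ _ _ _ _ _ (dl t)) /l scale1r.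
have : phi 1 <= phi 0.
  apply: (@ler0_derive1_nincr _ phi 0 1) => //.
  - move=> t; rewrite in_itv /= => /andP[t0 t1].
    by rewrite derive1E (@derive_val _ _ _ _ _ _ _ (dphi t)) subr_le0 hb // !ltW.
  - apply: continuous_subspaceT => t; apply: differentiable_continuous.
    exact/derivable1_diffP.
by rewrite /phi /q /l scale1r scale0r; lra.
Qed.

Lemma smooth_fun_upper (b : R) (h : 'cV[R]_n -> R) (x : 'cV[R]_n) :
  smooth_fun b h -> h x - h 0 <= 'd h 0 x + b / 2 * enorm x ^+ 2.
Proof.
move=> [dh hl].
have -> : b / 2 * enorm x ^+ 2 = (b * enorm x ^+ 2) / 2 by field.
apply: Taylor_upper => // t /andP[t0 _].
have := hl (t *: x) 0 x; rewrite subr0 enormZ (ger0_norm t0) => /ler_normlP[_].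
have -> : b * (t * enorm x) * enorm x = b * enorm x ^+ 2 * t by ring.
by rewrite lerBlDl.
Qed.

Lemma diff_coord k (g : 'cV[R]_n -> 'cV[R]_k) z a : differentiable g z ->
  differentiable (fun y => g y a 0) z /\
  forall v, 'd (fun y => g y a 0) z v = 'd g z v a 0.
Proof.
move=> dg; have dc M := @differentiable_coord R k 1 M a 0.
have dga : differentiable (fun y => g y a 0) z by exact: (differentiable_comp dg (dc _)).
split=> // v; rewrite -!deriveE // derive_mx; last exact: diff_derivable.
by rewrite mxE.
Qed.

(** Working coordinatewise reduces the vector remainder to the scalar bound, applied to the
    coordinate and to its opposite. *)
Lemma smooth_map_dist (b : R) (g : 'cV[R]_n -> 'cV[R]_n) (x : 'cV[R]_n) a :
  smooth_map b g ->
  `|(g x - g 0 - 'd g 0 x) a 0| <= b / 2 * enorm x ^+ 2.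
Proof.
move=> [dg hl]; rewrite !mxE.
have e : b / 2 * enorm x ^+ 2 = (b * enorm x ^+ 2) / 2 by field.
have up t : 0 <= t <= 1 ->
    `|'d g (t *: x) x a 0 - 'd g 0 x a 0| <= b * enorm x ^+ 2 * t.
  move=> /andP[t0 _]; have := hl (t *: x) 0 x.
  rewrite subr0 enormZ (ger0_norm t0) => H.
  have := coord_le_enorm ('d g (t *: x) x - 'd g 0 x) a; rewrite !mxE => H1.
  by apply: le_trans H1 _; apply: le_trans H _; rewrite le_eqVlt; apply/orP; left; apply/eqP; ring.
have dga z := diff_coord a (dg z).
have dNga z : differentiable (fun y => - g y a 0) z by apply: differentiableN; exact: (dga z).1.
have U : g x a 0 - g 0 a 0 <= 'd g 0 x a 0 + b * enorm x ^+ 2 / 2.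
  apply: (@Taylor_upper (fun y => g y a 0)) => [z|t t01]; first exact: (dga z).1.
  by rewrite (dga _).2; have /ler_normlP[_] := up t t01; rewrite lerBlDl.
have L : - g x a 0 - - g 0 a 0 <= - 'd g 0 x a 0 + b * enorm x ^+ 2 / 2.
  apply: (@Taylor_upper (fun y => - g y a 0)) => [z|t t01]; first exact: dNga.
  have -> : 'd (fun y => - g y a 0) (t *: x) x = - 'd g (t *: x) x a 0.
    by rewrite -(dga _).2 -!deriveE //; [apply: deriveN; apply: diff_derivable|]; exact: (dga _).1.
  by have /ler_normlP[+ _] := up t t01; rewrite opprB => H; rewrite -lerBlDl opprK addrC.
move: U L; set D := ('d g 0 x : 'cV_n) a 0; move: D => D U L.
by rewrite e ler_norml; apply/andP; split; lra.
Qed.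

End Taylor.

(** * Markov jump linear systems *)

Section Mjls.
Context {R : realType} {n nu : nat} (P : 'M[R]_nu) (G : 'I_nu -> 'M[R]_n).
Hypothesis sP : stochastic P.
Local Notation E := (Eauto P (mjls G)).

(** By linearity the run from [y + e] is the sum of the runs from [y] and [e] under the same modes,
    so a pointwise perturbation bound propagates in time. *)
Lemma Eauto_mjls_dist (F H1 H2 : 'cV[R]_n -> 'I_nu -> R) :
  (forall a b j, `|F (a + b) j - F a j| <= H1 a j + H2 b j) ->
  forall k y e i, `|E F (y + e) i k - E F y i k| <= E H1 y i k + E H2 e i k.
Proof.
move=> FH; elim=> [|k IH] y e i; first by rewrite !Eauto0.
rewrite !EautoS /mjls mulmxDr -sumrB -big_split /=.
apply: le_trans (ler_norm_sum _ _ _) _; apply: ler_sum => j _.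
rewrite -mulrBr -mulrDr normrM (ger0_norm (sP.1 i j)).
by apply: ler_wpM2l; [exact: sP.1|exact: IH].
Qed.

Section Summable.
Variable F : 'cV[R]_n -> R.
Hypothesis F_ge0 : forall z, 0 <= F z.
Hypothesis F_sum_le : forall (c : 'cV[R]_n) (Z : 'I_n -> 'cV[R]_n),
  F (\sum_a c a 0 *: Z a) <= F c * \sum_a F (Z a).
Hypothesis E_cvg0 : forall x i, (fun k => E (fun z _ => F z) x i k) @ \oo --> (0 : R).

Let EF x i k := E (fun z _ => F z) x i k.

Let EF_ge0 x i k : 0 <= EF x i k.
Proof. by apply: Eauto_ge0. Qed.

(** The flow maps a combination of initial states to the same combination of the trajectories, to
    which [F_sum_le] applies. *)
Lemma Eauto_mjls_le_basis x i k :
  EF x i k <= F x * \sum_a EF (delta_mx a 0) i k.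
Proof.
rewrite {1}(cV_sum_delta x).
(* The basis is replaced by an arbitrary family, since one step of the dynamics does not preserve
   it. *)
suff H Z : EF (\sum_a x a 0 *: Z a) i k <= F x * \sum_a EF (Z a) i k by exact: H.
rewrite /EF; elim: k i Z => [|k IH] i Z.
  by rewrite Eauto0; under [X in _ <= _ * X]eq_bigr => a _ do rewrite Eauto0; exact: F_sum_le.
rewrite EautoS; under [X in _ <= _ * X]eq_bigr => a _ do rewrite EautoS.
rewrite exchange_big mulr_sumr /=; apply: ler_sum => j _.
rewrite -mulr_sumr mulrCA; apply: ler_wpM2l; first exact: sP.1.
have -> : mjls G (\sum_a x a 0 *: Z a) i = \sum_a x a 0 *: mjls G (Z a) i.
  by rewrite /mjls mulmx_sumr; apply: eq_bigr => a _; rewrite -scalemxAr.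
exact: IH.
Qed.

(* Some finite horizon [K0] halves [F] in mean, uniformly in the initial
   state since it suffices to test a basis; hence [S_T <= S_K0 + S_T / 2]. *)
Lemma mjls_summable : exists C : R, 0 <= C /\
  forall T x i, \sum_(k < T) E (fun z _ => F z) x i k <= C * F x.
Proof.
have [K0 half] : exists K0, forall i, \sum_a EF (delta_mx a 0) i K0 <= 2^-1.
  have : \forall k \near \oo, forall i, \sum_a EF (delta_mx a 0) i k <= 2^-1.
    apply: filter_forall => i.
    have c0 : (fun k => \sum_(a < n) EF (delta_mx a 0) i k) @ \oo --> (0 : R).
      rewrite [X in _ --> X](_ : _ = \sum_(a < n) (0 : R)); last by rewrite big1.
      by apply: cvg_big => [|a _]; [exact: add_continuous|exact: E_cvg0].
    have h0 : (0 : R) < 2^-1 by rewrite invr_gt0.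
    by apply: filterS (cvgr_lt _ c0 _ h0) => k /ltW.
  by case=> K0 _ H; exists K0; apply: H => /=.
(* Summing over all modes [j] makes the constant independent of the initial mode. *)
pose B := \sum_(k < K0) \sum_j \sum_a EF (delta_mx a 0) j k.
exists (2 * B); split.
  rewrite mulr_ge0 //; apply: sumr_ge0 => k _; apply: sumr_ge0 => j _.
  exact: sumr_ge0.
move=> T x i; rewrite -/(EF x i).
have first : \sum_(k < K0) EF x i k <= B * F x.
  rewrite /B mulr_suml; apply: ler_sum => k _.
  apply: le_trans (Eauto_mjls_le_basis x i k) _; rewrite mulrC ler_wpM2r //.
  rewrite (bigD1 i) //= lerDl; apply: sumr_ge0 => j _; exact: sumr_ge0.
have tail : \sum_(k < T) EF x i (K0 + k)%N <= 2^-1 * \sum_(k < T) EF x i k.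
  rewrite mulr_sumr; apply: ler_sum => k _; rewrite addnC /EF Eauto_Markov -EautoZ.
  apply: ler_Eauto => // y j; apply: le_trans (Eauto_mjls_le_basis y j K0) _.
  by rewrite mulrC ler_wpM2r.
have : \sum_(k < T) EF x i k <= \sum_(k < K0 + T) EF x i k.
  by rewrite addnC big_split_ord /= lerDl sumr_ge0.
rewrite big_split_ord /= => H.
have {}H : \sum_(k < T) EF x i k <= B * F x + 2^-1 * \sum_(k < T) EF x i k.
  by apply: le_trans H _; apply: lerD.
by move: H; set S := \sum_(k < T) EF x i k; lra.
Qed.

End Summable.

Lemma mjls_summable_sqr : mjls_ms_stable P G -> exists C : R, 0 <= C /\
  forall T x i, \sum_(k < T) msq P (mjls G) x i k <= C * enorm x ^+ 2.
Proof.
move=> st; apply: (mjls_summable (F := fun z => enorm z ^+ 2)) => [z|c Z|x i].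
- exact: sqr_ge0.
- exact: sqr_enorm_sum_le.
- exact: st.
Qed.

Lemma mjls_summable_norm : mjls_ms_stable P G -> exists C : R, 0 <= C /\
  forall T x i, \sum_(k < T) E (fun z _ => `|z|) x i k <= C * `|x|.
Proof.
move=> st; apply: (mjls_summable (F := fun z => `|z|)) => [z|c Z|x i] //.
  exact: mx_norm_sum_le.
apply/cvgrPdist_lt => e e0.
have e2 : 0 < e ^+ 2 by rewrite exprn_gt0.
near=> k.
have lt : msq P (mjls G) x i k < e ^+ 2.
  by near: k; exact: (cvgr_lt _ (st x i) _ e2).
rewrite sub0r normrN ger0_norm; last by apply: Eauto_ge0.
(* Second moments control first ones through [|z| <= e / 2 + |z|^2 / (2 e)], with [e] the target
   accuracy. *)
have : E (fun z _ => `|z|) x i k <= E (fun z _ => 2^-1 * e + (2 * e)^-1 * enorm z ^+ 2) x i k.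
  apply: ler_Eauto => // y _; apply: le_trans (mx_norm_le_enorm y) _.
  rewrite -subr_ge0 (_ : _ - _ = (2 * e)^-1 * (e - enorm y) ^+ 2); last by field; lra.
  by rewrite mulr_ge0 ?sqr_ge0 // invr_ge0 ltW // mulr_gt0.
rewrite EautoD Eauto_cst // EautoZ => /le_lt_trans; apply.
have : (2 * e)^-1 * msq P (mjls G) x i k < (2 * e)^-1 * e ^+ 2.
  by rewrite ltr_pM2l // invr_gt0 mulr_gt0.
rewrite (_ : _ * e ^+ 2 = 2^-1 * e); last by field; lra.
rewrite /msq; set m := Eauto _ _ _ _ _ _; lra.
Unshelve. all: by end_near. Qed.

Section TerminalCost.
Variables (alpha : R) (betal : 'I_nu -> R) (dl0 : 'I_nu -> 'cV[R]_n -> R).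
Variables (C1 C2 D W : R).
Hypothesis C1P : forall T x i, \sum_(k < T) E (fun z _ => `|z|) x i k <= C1 * `|x|.
Hypothesis C2P : forall T x i, \sum_(k < T) msq P (mjls G) x i k <= C2 * enorm x ^+ 2.
Hypothesis W_ge0 : 0 <= W.
Hypothesis WP : forall j, `|2^-1 * (alpha + betal j)| <= W.
Hypothesis D_ge0 : 0 <= D.
Hypothesis DP : forall j z, `|dl0 j z| <= D * `|z|.
Hypothesis dl0D : forall j a b, dl0 j (a + b) = dl0 j a + dl0 j b.

Local Notation l := (lq alpha betal dl0).
Local Notation V := (Vf P G alpha betal dl0).

Lemma sum_Eauto_lin_le (c1 c2 : R) T x i : 0 <= c1 -> 0 <= c2 ->
  \sum_(k < T) E (fun z _ => c2 * enorm z ^+ 2 + c1 * `|z|) x i k <=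
  c2 * (C2 * enorm x ^+ 2) + c1 * (C1 * `|x|).
Proof.
move=> c10 c20; under eq_bigr => k _ do rewrite EautoD !EautoZ.
rewrite big_split /= -!mulr_sumr; apply: lerD; apply: ler_wpM2l => //.
- exact: C2P.
- exact: C1P.
Qed.

Lemma lq_norm z j : `|l z j| <= W * enorm z ^+ 2 + D * `|z|.
Proof.
apply: le_trans (ler_normD _ _) _; apply: lerD; last exact: DP.
by rewrite normrM (ger0_norm (sqr_ge0 _)) ler_wpM2r ?sqr_ge0.
Qed.

Lemma sum_norm_lq_le T x i : \sum_(k < T) `|E l x i k| <=
  W * (C2 * enorm x ^+ 2) + D * (C1 * `|x|).
Proof.
apply: le_trans (sum_Eauto_lin_le T x i D_ge0 W_ge0).
apply: ler_sum => k _; apply: le_trans (ler_norm_Eauto _ sP _ _ _ _) _.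
by apply: ler_Eauto => // y j; exact: lq_norm.
Qed.

Lemma Vf_cvg x i : cvgn (series (fun k => E l x i k)).
Proof. by apply: bounded_abs_series_cvg => T; exact: sum_norm_lq_le. Qed.

Lemma Vf_norm_le x i : `|V x i| <= W * (C2 * enorm x ^+ 2) + D * (C1 * `|x|).
Proof. by apply: norm_limn_series_le => T; exact: sum_norm_lq_le. Qed.

(** The Young parameter [s] stays free: for [y] of order r and [e] of order r^2, taking [s] = r
    makes both quadratic terms O(r^3). *)
Lemma Vf_dist_le s y e i : 0 < s ->
  `|V (y + e) i - V y i| <= W * s * (C2 * enorm y ^+ 2) +
    (W * (1 + s^-1) * (C2 * enorm e ^+ 2) + D * (C1 * `|e|)).
Proof.
move=> s0; have s1 : 0 <= 1 + s^-1 by rewrite addr_ge0 // invr_ge0 ltW.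
rewrite /Vf -(lim_seriesB (@Vf_cvg (y + e) i) (@Vf_cvg y i)).
apply: norm_limn_series_le => T.
have F2 := sum_Eauto_lin_le T e i D_ge0 (mulr_ge0 W_ge0 s1).
have F1 : \sum_(k < T) E (fun z _ => W * s * enorm z ^+ 2) y i k <=
    W * s * (C2 * enorm y ^+ 2).
  under eq_bigr => k _ do rewrite EautoZ.
  by rewrite -mulr_sumr ler_wpM2l ?C2P // mulr_ge0 // ltW.
apply: le_trans (lerD F1 F2); rewrite -big_split /=; apply: ler_sum => k _.
apply: Eauto_mjls_dist => a b j; rewrite /lq.
rewrite (_ : _ - _ = 2^-1 * (alpha + betal j) * (enorm (a + b) ^+ 2 - enorm a ^+ 2) + dl0 j b);
  last by rewrite dl0D; ring.
apply: le_trans (ler_normD _ _) _; rewrite addrA; apply: lerD; last exact: DP.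
rewrite normrM -!mulrA -mulrDr; apply: ler_pM => //; exact: sqr_enormD_dist.
Qed.

(** The partial sums satisfy the one-step recursion, which passes to the limit because the sum over
    modes is finite. *)
Lemma Vf_Bellman x i : V x i = l x i + \sum_j P i j * V (G i *m x) j.
Proof.
apply/cvg_lim => //; rewrite -cvg_shiftS.
have -> : (fun T => series (fun k => E l x i k) T.+1) =
    fun T => l x i + \sum_j P i j * series (fun k => E l (G i *m x) j k) T.
  apply/funext => T; rewrite /series /= big_nat_recl // Eauto0; congr (_ + _).
  under eq_bigr => k _ do rewrite EautoS.
  by rewrite exchange_big /=; apply: eq_bigr => j _; rewrite mulr_sumr.
apply: cvgD; first exact: cvg_cst.
apply: cvg_big => [|j _]; first exact: add_continuous.
by apply: cvgM; [exact: cvg_cst|exact: Vf_cvg].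
Qed.

End TerminalCost.
End Mjls.

(** * Decrease of the terminal cost near the steady state *)

Section TerminalDecrease.
Context {R : realType} {n nu : nat} (P : 'M[R]_nu) (G : 'I_nu -> 'M[R]_n).
Variables (fhat : 'I_nu -> 'cV[R]_n -> 'cV[R]_n) (lbar : 'cV[R]_n -> 'I_nu -> R).
Variables (betaf betal : 'I_nu -> R) (dl0 : 'I_nu -> 'cV[R]_n -> R) (D : R).
Hypothesis sP : stochastic P.
Hypothesis stG : mjls_ms_stable P G.
Hypothesis D_ge0 : 0 <= D.
Hypothesis DP : forall j z, `|dl0 j z| <= D * `|z|.
Hypothesis dl0D : forall j a b, dl0 j (a + b) = dl0 j a + dl0 j b.
Hypothesis fhat_dist : forall i x a,
  `|(fhat i x - G i *m x) a 0| <= betaf i / 2 * enorm x ^+ 2.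
Hypothesis lbar_le : forall x i,
  lbar x i <= dl0 i x + betal i / 2 * enorm x ^+ 2.

(* The linear part of [Vf] does not depend on [alpha] and turns the quadratic
   linearization error into a term of order [|x|^2], which fixes [alpha]; the
   quadratic part contributes [O(|x|^3)], which fixes [delta]. *)
Lemma terminal_cost_decrease : exists delta alpha : R, [/\ 0 < delta, 0 < alpha,
  (forall x i, enorm x < delta ->
     \sum_j P i j * Vf P G alpha betal dl0 (fhat i x) j - Vf P G alpha betal dl0 x i
     <= - lbar x i)
  & exists M, forall x i, enorm x < delta -> - M <= Vf P G alpha betal dl0 x i].
Proof.
have [C1 [C1_ge0 C1P]] := mjls_summable_norm sP stG.
have [C2 [C2_ge0 C2P]] := mjls_summable_sqr sP stG.
pose b : R := \sum_i `|betaf i|.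
have b_ge0 : 0 <= b by exact: sumr_ge0.
have le_b i : betaf i <= b.
  apply: le_trans (ler_norm _) _.
  by rewrite /b (bigD1 i) //= lerDl sumr_ge0.
(* The linear part of [Vf] loses at most [D * C1 * b / 2 * r ^+ 2]; the added 1 leaves [r ^+ 2 / 2]
   for the quadratic part. *)
pose alpha : R := D * C1 * b + 1.
have alpha_gt0 : 0 < alpha by rewrite ltr_wpDl // !mulr_ge0.
pose W : R := \sum_j `|2^-1 * (alpha + betal j)|.
have W_ge0 : 0 <= W by exact: sumr_ge0.
have WP j : `|2^-1 * (alpha + betal j)| <= W.
  by rewrite /W (bigD1 j) //= lerDl sumr_ge0.
pose Gc : R := \sum_i \sum_a enorm (col a (G i)) ^+ 2.
have Gc_ge0 : 0 <= Gc by apply: sumr_ge0 => i _; apply: sumr_ge0 => a _; exact: sqr_ge0.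
have le_Gc i x : enorm (G i *m x) ^+ 2 <= enorm x ^+ 2 * Gc.
  apply: le_trans (sqr_enorm_mulmx_le _ _) _; rewrite ler_wpM2l ?sqr_ge0 //.
  rewrite /Gc (bigD1 i) //= lerDl; apply: sumr_ge0 => j _; apply: sumr_ge0 => a _.
  exact: sqr_ge0.
pose m : R := n%:R.
have m_ge0 : 0 <= m by rewrite ler0n.
(* [q] bounds the coefficient [Gc + m * b ^+ 2 / 4 * (1 + r)] once r <= 1. The radius below gives
   [r * (1 + 2 * Q) < 1], hence both r <= 1 and [r * Q <= 1 / 2]. *)
pose q : R := Gc + m * b ^+ 2 / 2.
have q_ge0 : 0 <= q by rewrite addr_ge0 // divr_ge0 // mulr_ge0 // sqr_ge0.
pose Q : R := W * C2 * q.
have Q_ge0 : 0 <= Q by rewrite !mulr_ge0.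
pose delta : R := (1 + 2 * Q)^-1.
have delta_gt0 : 0 < delta by rewrite invr_gt0; lra.
have V_dist := Vf_dist_le sP C1P C2P W_ge0 WP D_ge0 DP dl0D.
have key x i j : enorm x < delta ->
    Vf P G alpha betal dl0 (fhat i x) j <=
    Vf P G alpha betal dl0 (G i *m x) j + 2^-1 * alpha * enorm x ^+ 2.
  move=> xd; pose y := G i *m x; pose e := fhat i x - y.
  have ye : fhat i x = y + e by rewrite addrC subrK.
  rewrite ye -/y; set r := enorm x.
  have r_ge0 : 0 <= r by exact: enorm_ge0.
  have e_le a : `|e a 0| <= b / 2 * r ^+ 2.
    apply: le_trans (fhat_dist i x a) _; rewrite ler_wpM2r ?sqr_ge0 //.
    by rewrite ler_wpM2r // invr_ge0.
  have c_ge0 : 0 <= b / 2 * r ^+ 2 by rewrite !mulr_ge0 // ?invr_ge0 // sqr_ge0.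
  have E1 : `|e| <= b / 2 * r ^+ 2 by apply: mx_norm_le_coord.
  have E2 : enorm e ^+ 2 <= m * (b / 2 * r ^+ 2) ^+ 2.
    rewrite sqr_enorm; apply: (@le_trans _ _ (\sum_(a < n) (b / 2 * r ^+ 2) ^+ 2)).
      by apply: ler_sum => a _; rewrite -[leLHS]real_normK ?num_real // lerXn2r ?nnegrE.
    by rewrite sumr_const card_ord /m mulr_natl.
  have Y2 : enorm y ^+ 2 <= r ^+ 2 * Gc by exact: le_Gc.
  have rd : r * (1 + 2 * Q) < 1.
    have Q1 : 0 < 1 + 2 * Q by lra.
    by rewrite -ltr_pdivlMr // div1r.
  have lin : D * (C1 * `|e|) <= D * (C1 * (b / 2 * r ^+ 2)) by rewrite !ler_wpM2l.
  have sqr s : 0 < s -> W * s * (C2 * enorm y ^+ 2) + W * (1 + s^-1) * (C2 * enorm e ^+ 2)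
      <= W * C2 * (s * (r ^+ 2 * Gc) + (1 + s^-1) * (m * (b / 2 * r ^+ 2) ^+ 2)).
    move=> s0; have s1 : 0 <= 1 + s^-1 by rewrite addr_ge0 // invr_ge0 ltW.
    rewrite (_ : _ + _ = W * C2 * (s * enorm y ^+ 2 + (1 + s^-1) * enorm e ^+ 2)); last by ring.
    rewrite ler_wpM2l ?mulr_ge0 // lerD // ler_wpM2l // ltW //.
  suff [s s0 hs] : exists2 s, 0 < s &
      W * C2 * (s * (r ^+ 2 * Gc) + (1 + s^-1) * (m * (b / 2 * r ^+ 2) ^+ 2)) <= 2^-1 * r ^+ 2.
    have /ler_normlP[_] := V_dist s y e j s0; have := sqr s s0.
    rewrite lerBlDl => h1 h2; apply: le_trans h2 _; rewrite lerD2l addrA.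
    apply: le_trans (lerD (le_trans h1 hs) lin) _.
    by rewrite le_eqVlt; apply/orP; left; apply/eqP; rewrite /alpha; field.
  (* The choice [s] = r makes the error cubic. As [s] must be positive, r = 0 is treated apart with
     [s] = 1, where every term vanishes. *)
  move: r_ge0; rewrite le_eqVlt => /predU1P[r0|r_gt0].
    by exists 1 => //; rewrite -r0 expr0n /= !(mulr0, mul0r) expr0n /= !(mulr0, addr0).
  exists r => //.
  have r1 : r <= 1.
    have : 0 <= r * (2 * Q) by rewrite !mulr_ge0 // ltW.
    by move: rd; rewrite mulrDr mulr1; lra.
  rewrite (_ : _ * _ = r ^+ 2 * (r * (W * C2 * (Gc + m * b ^+ 2 / 4 * (1 + r))))); last first.
    by field; lra.
  rewrite mulrC ler_wpM2r ?sqr_ge0 //.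
  apply: (@le_trans _ _ (r * Q)); last by move: rd; rewrite mulrDr mulr1; lra.
  rewrite ler_wpM2l ?(ltW r_gt0) // /Q ler_wpM2l ?mulr_ge0 // /q lerD2l.
  rewrite (_ : m * b ^+ 2 / 2 = m * b ^+ 2 / 4 * 2); last by field.
  by rewrite ler_wpM2l ?divr_ge0 ?mulr_ge0 ?sqr_ge0 //; lra.
exists delta, alpha; split=> // [x i xd|].
  (* The [alpha] part of [lq] pays for replacing [G i *m x] by [fhat i x]; what remains of [lq]
     dominates [lbar]. *)
  rewrite (Vf_Bellman sP C1P C2P W_ge0 WP D_ge0 DP x i) /lq.
  have H : \sum_j P i j * Vf P G alpha betal dl0 (fhat i x) j <=
      \sum_j P i j * (Vf P G alpha betal dl0 (G i *m x) j + 2^-1 * alpha * enorm x ^+ 2).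
    by apply: mean_le => // j _; exact: key.
  move: H; under [X in _ <= X]eq_bigr => j _ do rewrite mulrDr.
  rewrite big_split /= mean_cst //; have := lbar_le x i.
  move: (\sum_j _) (\sum_j _) (dl0 i x) (lbar x i) (enorm x ^+ 2) => S1 S2 d lb r2.
  by nra.
exists (W * (C2 * delta ^+ 2) + D * (C1 * delta)) => x i xd.
have /ler_normlP[H _] := Vf_norm_le sP C1P C2P W_ge0 WP D_ge0 DP x i.
rewrite lerNl; apply: le_trans H _; apply: lerD; apply: ler_wpM2l => //; apply: ler_wpM2l => //.
  by rewrite lerXn2r ?nnegrE ?enorm_ge0 // ltW.
exact: le_trans (mx_norm_le_enorm x) (ltW xd).
Qed.

End TerminalDecrease.

(** * The optimal control problem *)

Section Ocp.
Context {R : realType} {n m nu : nat} (P : 'M[R]_nu)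
  (f : 'cV[R]_n -> 'cV[R]_m -> 'I_nu -> 'cV[R]_n)
  (ell : 'cV[R]_n -> 'cV[R]_m -> 'I_nu -> R) (V : 'cV[R]_n -> 'I_nu -> R)
  (Y : 'I_nu -> set ('cV[R]_n * 'cV[R]_m)) (Xf : 'I_nu -> set 'cV[R]_n).
Hypothesis sP : stochastic P.
Implicit Types mu : seq 'I_nu -> 'cV[R]_m.

Let shift mu i : seq 'I_nu -> 'cV[R]_m := fun h => mu (i :: h).

(* Dynamic-programming forms of [ocp_cost] and [ocp_admissible]: after the
   first step the policy continues as [fun h => mu (i :: h)]. *)
Fixpoint rcost k mu x i : R :=
  if k is k'.+1 then
    ell x (mu [:: i]) i +
    \sum_j P i j * rcost k' (fun h => mu (i :: h)) (f x (mu [:: i]) i) j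
  else V x i.

Lemma rcostS k mu x i : rcost k.+1 mu x i = ell x (mu [:: i]) i +
  \sum_j P i j * rcost k (fun h => mu (i :: h)) (f x (mu [:: i]) i) j.
Proof. by []. Qed.

Fixpoint radm k mu x i : Prop :=
  if k is k'.+1 then
    Y i (x, mu [:: i]) /\
    forall j, 0 < P i j -> radm k' (fun h => mu (i :: h)) (f x (mu [:: i]) i) j
  else Xf i x.

Lemma pstate_shift mu i h : forall x pre,
  pstate f mu x (i :: pre) h = pstate f (shift mu i) x pre h.
Proof. by elim: h => [|th h IH] x pre //=; rewrite -IH. Qed.

Lemma xat_shift mu x i h k :
  xat f mu x (i :: h) k.+1 = xat f (shift mu i) (f x (mu [:: i]) i) h k.
Proof. by rewrite /xat /= pstate_shift. Qed.

Lemma ocp_costE k mu x i : ocp_cost k P f ell V mu x i = rcost k mu x i.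
Proof.
elim: k mu x i => [|k IH] mu x i.
  by rewrite /ocp_cost sum_tuple0 /= mul1r big_ord0 addr0.
have step j : rcost k (shift mu i) (f x (mu [:: i]) i) j =
  ocp_cost k P f ell V (shift mu i) (f x (mu [:: i]) i) j by rewrite IH.
(* The first stage cost is deterministic: it is spread over the modes [j], then over the paths, both
   of total weight 1. *)
rewrite /= -(mean_cst i (ell x (mu [:: i]) i) sP) -big_split /=.
rewrite /ocp_cost (sum_tupleS k (fun t : seq _ => hprob P i t *
  (V (xat f mu x (i :: t) k.+1) (last i t) +
   \sum_(j < k.+1) ell (xat f mu x (i :: t) j) (mu (take j.+1 (i :: t)))
                       (nth i (i :: t) j)))).
apply: eq_bigr => j _; rewrite -/(shift mu i) step /ocp_cost /= -mulrDr.
rewrite -[in RHS](mul1r (ell _ _ _)) -(sum_hprob sP k j) mulr_suml -big_split /=.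
rewrite mulr_sumr; apply: eq_bigr => t _; rewrite -mulrA -mulrDr; congr (_ * (_ * _)).
rewrite big_ord_recl /= xat_shift addrCA; congr (_ + (_ + _)).
apply: eq_bigr => l _; rewrite /bump /= xat_shift.
(* Passing to the tail changes the default of [nth] from [i] to [j], harmless since the index is in
   range. *)
by rewrite (@set_nth_default _ _ j i) //= size_tuple add0n ltnS ltnW.
Qed.

Lemma ocp_admissibleP k mu x i :
  ocp_admissible k P f Y Xf mu x i <-> radm k mu x i.
Proof.
elim: k mu x i => [|k IH] mu x i /=; split.
- by move=> /(_ [tuple])/= /(_ ltr01)[].
- by move=> Xx t _; rewrite (tuple0 t) /=; split.
- move=> adm; split.
    (* The constraint at time 0 is read off any path of positive probability. *)
    by have [t /adm[+ _]] := hprob_pos sP k.+1 i; move=> /(_ 0%N erefl); rewrite /= take0.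
  move=> j Pij; apply/IH => t tj.
  have /adm[Yt Xt] : 0 < hprob P i [tuple of j :: t] by exact: mulr_gt0.
  split=> [l lk|]; last by move: Xt; rewrite xat_shift.
  have := Yt l.+1 lk; rewrite xat_shift /=.
  by rewrite (@set_nth_default _ _ j i) //= size_tuple ltnS ltnW.
- move=> [Y0 radmS] t; case/tupleP: t => j t /= Pt.
  have Pij : 0 < P i j.
    by rewrite lt_neqAle sP.1 andbT; apply: contraTneq Pt => <-; rewrite mul0r ltxx.
  have tj : 0 < hprob P j t by move: Pt; rewrite pmulr_rgt0.
  have [Yt Xt] := (IH _ _ _).2 (radmS j Pij) t tj.
  split=> [[_|l lk]|]; [exact: Y0| |by rewrite xat_shift].
  have := Yt l lk; rewrite xat_shift /=.
  by rewrite (@set_nth_default _ _ j i) //= size_tuple ltnS ltnW.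
Qed.

(** From mode [i] a policy is only consulted on histories starting with [i]; this permits splicing
    policies. *)
Lemma eq_radm k mu mu' x i : (forall h, mu (i :: h) = mu' (i :: h)) ->
  radm k mu x i -> radm k mu' x i.
Proof.
elim: k mu mu' x i => [|k IH] mu mu' x i e //=; rewrite e => -[Y0 H]; split=> // j Pij.
by apply: IH (H j Pij) => h; exact: e.
Qed.

Lemma rcost_ge (M : R) : (forall x u i, 0 <= ell x u i) ->
  (forall i x, Xf i x -> - M <= V x i) ->
  forall k mu x i, radm k mu x i -> - M <= rcost k mu x i.
Proof.
move=> l0 VM; elim=> [|k IH] mu x i /=; first exact: VM.
move=> [_ adm]; have : \sum_j P i j * - M <=
    \sum_j P i j * rcost k (shift mu i) (f x (mu [:: i]) i) j.
  by apply: mean_le => // j Pij; apply: IH; exact: adm.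
by rewrite mean_cst // => H; apply: le_trans H _; rewrite lerDr.
Qed.

Section Extension.
Variables (K : 'I_nu -> 'M[R]_(m, n)) (c : R).
Hypothesis upi : UPI P f K Y Xf.
Hypothesis decr : forall i x, Xf i x ->
  ell x (K i *m x) i + \sum_j P i j * V (f x (K i *m x) i) j <= V x i + c.

(* Append the terminal controller to an admissible policy. *)
Lemma extend_policy k mu x i : radm k mu x i ->
  exists mu', radm k.+1 mu' x i /\ rcost k.+1 mu' x i <= rcost k mu x i + c.
Proof.
elim: k mu x i => [|k IH] mu x i.
  move=> Xx; have [Yx Xn] := upi Xx.
  by exists (fun _ => K i *m x); split; [split|exact: decr].
move=> [Y0 adm].
(* One extended continuation per next mode; [mu] is a dummy value for impossible transitions. *)
have /choice[ext extP] j : exists mu', 0 < P i j ->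
    radm k.+1 mu' (f x (mu [:: i]) i) j /\
    rcost k.+1 mu' (f x (mu [:: i]) i) j <=
    rcost k (fun h => mu (i :: h)) (f x (mu [:: i]) i) j + c.
  case: (pselect (0 < P i j)) => [Pij|nPij]; last by exists mu.
  by have [mu' H] := IH _ _ _ (adm j Pij); exists mu'.
(* The first input is kept; from the second mode [j] on, the history without its head is handed to
   [ext j]. *)
pose mu' h := if h is _ :: (j :: _) as h' then ext j h' else mu [:: i].
have agree j h : ext j (j :: h) = (fun h => mu' (i :: h)) (j :: h) by [].
exists mu'; split.
  split; first exact: Y0.
  by move=> j Pij; exact: (@eq_radm k.+1 _ _ _ _ (agree j) (extP j Pij).1).
rewrite rcostS [in leRHS]rcostS -addrA lerD2l -(mean_cst i c sP) -big_split /=.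
under [leRHS]eq_bigr => j _ do rewrite -mulrDr.
by apply: mean_le => // j Pij; exact: (extP j Pij).2.
Qed.

End Extension.
End Ocp.

(** * Lower bounds on compact sets and positivity of the stationary law *)

Section Stability.
Context {R : realType}.

(** Near each point [h] exceeds its value there minus 1, and compactness makes the threshold
    uniform. The set lies in a product because the constraints bind state and input jointly. *)
Lemma lsc_compact_lower_bound (T U : topologicalType) (h : T -> R) (A : set (T * U)) :
  lsc h -> compact A -> exists M, forall p, A p -> - M <= h p.1.
Proof.
move=> hl /compact_near_coveringP cA.
have /filter_ex[M AM] : \forall M \near +oo%R, A `<=` (fun p => - M <= h p.1).
  apply: cA => x _; exists ([set q | h x.1 - 1 < h q.1], [set M | 1 - h x.1 <= M]).
    split=> /=; last exact: nbhs_pinfty_ge (num_real _).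
    exists ([set a | h x.1 - 1 < h a], setT) => /=; last by move=> q [].
    by split; [exact: hl|exact: filterT].
  by move=> [q M] /= [h1 h2]; lra.
by exists M.
Qed.

(** Some [i] carries mass, and by invariance under [P ^+ k] a positive share [pi i * (P ^+ k) i j]
    of it reaches [j]. *)
Lemma stationary_gt0 nu (P : 'M[R]_nu) pi :
  stochastic P -> irreducible P -> stationary P pi -> forall j, 0 < pi j.
Proof.
move=> sP irr [pi0 pi1 piP] j.
have [i pii] : exists i, 0 < pi i.
  apply: contrapT => /forallNP H; move: pi1; rewrite big1 => [/esym/eqP|i _].
    by rewrite oner_eq0.
  by apply/eqP; rewrite eq_le pi0 andbT leNgt; apply/negP/H.
have [k [_ Pk]] := irr i j.
have invariant l j' : \sum_i pi i * (P ^+ l) i j' = pi j'.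
  elim: l j' => [|l IH] j'.
    rewrite (bigD1 j') //= expr0 mxE eqxx mulr1 big1 ?addr0 // => i' ne.
    by rewrite mxE (negbTE ne) mulr0.
  rewrite exprSr; under eq_bigr => i' _ do rewrite mxE mulr_sumr.
  rewrite exchange_big /= -[RHS]piP; apply: eq_bigr => l' _.
  by rewrite -(IH l') mulr_suml; apply: eq_bigr => i' _; rewrite mulrA.
rewrite lt_neqAle pi0 andbT; apply/eqP => /esym z.
have P0 l i' j' : 0 <= (P ^+ l) i' j'.
  elim: l i' j' => [|l IH] i' j'; first by rewrite expr0 mxE ler0n.
  by rewrite exprSr mxE sumr_ge0 // => l' _; rewrite mulr_ge0 ?sP.1.
have := invariant k j; rewrite z => /eqP; rewrite psumr_eq0 => [|i' _]; last exact: mulr_ge0.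
by move=> /allP/(_ i (mem_index_enum _)) /=; rewrite gt_eqF // mulr_gt0.
Qed.

End Stability.

(** * Mean square stability of the closed loop *)

Section Empc.
Context {R : realType} {n m nu : nat} (N : nat) (P : 'M[R]_nu)
  (f : 'cV[R]_n -> 'cV[R]_m -> 'I_nu -> 'cV[R]_n)
  (ell : 'cV[R]_n -> 'cV[R]_m -> 'I_nu -> R) (V : 'cV[R]_n -> 'I_nu -> R)
  (Y : 'I_nu -> set ('cV[R]_n * 'cV[R]_m)) (Xf : 'I_nu -> set 'cV[R]_n)
  (K : 'I_nu -> 'M[R]_(m, n)) (kappa : 'cV[R]_n -> 'I_nu -> 'cV[R]_m)
  (lam rho : 'cV[R]_n -> 'I_nu -> R) (ell_s gamma M : R).
Hypothesis sP : stochastic P.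
Hypothesis Y_compact : forall i, compact (Y i).
Hypothesis ell_ge0 : forall x u i, 0 <= ell x u i.
Hypothesis upi : UPI P f K Y Xf.
Hypothesis decr : forall i x, Xf i x ->
  ell x (K i *m x) i + \sum_j P i j * V (f x (K i *m x) i) j <= V x i + ell_s.
Hypothesis V_ge : forall i x, Xf i x -> - M <= V x i.
Hypothesis lam_lsc : forall i, lsc (fun x => lam x i).
Hypothesis dissipative : forall x u i,
  \sum_j P i j * lam (f x u i) j - lam x i <= ell x u i - ell_s - rho x i.
Hypothesis gamma_gt0 : 0 < gamma.
Hypothesis rho_ge : forall x i, gamma * enorm x ^+ 2 <= rho x i.
Hypothesis kappaP : empc_law N.+1 P f ell Y Xf V kappa.

(* The Lyapunov function is the optimal value plus the storage function. *)
Lemma empc_ms_stable x0 i0 : ocp_feasible N.+1 P f Y Xf x0 i0 ->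
  ms_conv P (fun x i => f x (kappa x i) i) x0 i0.
Proof.
pose D x i := ocp_feasible N.+1 P f Y Xf x i.
pose rc k := rcost P f ell V k; pose ra k := radm P f Y Xf k.
have /choice[mu muP] (p : 'cV[R]_n * 'I_nu) : exists mu, D p.1 p.2 ->
    [/\ ra N.+1 mu p.1 p.2,
      forall mu', ra N.+1 mu' p.1 p.2 -> rc N.+1 mu p.1 p.2 <= rc N.+1 mu' p.1 p.2
      & mu [:: p.2] = kappa p.1 p.2].
  case: (pselect (D p.1 p.2)) => [Dp|nD]; last by exists (fun _ => 0).
  have [mu [adm opt e]] := kappaP Dp; exists mu => _; split=> //.
    exact/ocp_admissibleP.
  by move=> mu' /(ocp_admissibleP f Y Xf sP) /opt; rewrite !ocp_costE.
have /choice[L LP] i := lsc_compact_lower_bound (@lam_lsc i) (@Y_compact i).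
pose L0 : R := \sum_i `|L i|.
have lam_ge x i : D x i -> - L0 <= lam x i.
  (* A feasible state is the first component of a point of the compact [Y i], by the constraint at
     time 0. *)
  move=> /(muP (x, i))[/= [Yx _] _ _]; apply: le_trans (LP i _ Yx); rewrite lerN2.
  by apply: le_trans (ler_norm _) _; rewrite /L0 (bigD1 i) //= lerDl sumr_ge0.
pose W x i := rc N.+1 (mu (x, i)) x i + lam x i.
pose g x i := f x (kappa x i) i.
(* The tail of the optimal policy, one step short at the successor, is completed by the terminal
   controller; this gives recursive feasibility and the cost comparison. *)
have succ x i j : D x i -> 0 < P i j -> exists mu', ra N.+1 mu' (g x i) j /\
    rc N.+1 mu' (g x i) j <= rc N (fun h => mu (x, i) (i :: h)) (g x i) j + ell_s.
  move=> /(muP (x, i))[/= [_ adm] _ e] Pij; rewrite /g -e.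
  exact: (extend_policy sP upi decr (adm j Pij)).
have Dg x i : D x i -> forall j, 0 < P i j -> D (g x i) j.
  move=> Dx j Pij; have [mu' [adm _]] := succ x i j Dx Pij.
  by exists mu'; exact/ocp_admissibleP.
have W_ge x i : D x i -> 0 <= W x i + (M + L0).
  move=> Dx; have [adm _ _] := muP (x, i) Dx.
  have := rcost_ge sP ell_ge0 V_ge adm; have := lam_ge _ _ Dx.
  by rewrite /W /rc /=; lra.
(* Optimality at the successor beats the extended tail; the stage cost released this way cancels
   against dissipativity, leaving [- rho]. *)
have drift x i : D x i -> \sum_j P i j * W (g x i) j <= W x i - gamma * enorm x ^+ 2.
  move=> Dx; have [_ _ e] := muP (x, i) Dx.
  apply: (@le_trans _ _ (\sum_j P i j * (rc N (fun h => mu (x, i) (i :: h)) (g x i) j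
                         + ell_s + lam (g x i) j))).
    apply: mean_le => // j Pij; rewrite /W lerD2r.
    have [mu' [adm le]] := succ x i j Dx Pij; apply: le_trans le.
    by have [_ opt _] := muP (g x i, j) (Dg x i Dx j Pij); exact: opt.
  under eq_bigr => j _ do rewrite !mulrDr.
  rewrite !big_split /= mean_cst // /W /rc rcostS /= e -/(g x i).
  have := rho_ge x i; have := dissipative x (kappa x i) i; rewrite -/(g x i).
  move: (\sum_j _) (\sum_j _) => S1 S2; lra.
move=> Dx0; have bound := sum_Eauto_le_drift sP Dg W_ge drift _ Dx0.
apply: cvg_series_cvg_0.
apply: (@bounded_series_cvg _ _ (gamma^-1 * (W x0 i0 + (M + L0)))) => [k|T].
  by apply: Eauto_ge0 => // y _; exact: sqr_ge0.
rewrite ler_pdivlMl // mulr_sumr; apply: le_trans (bound T).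
by apply: ler_sum => k _; rewrite EautoZ.
Qed.

End Empc.

(** Since [x] enters through the linear map to [(x, K *m x)], the difference quotients of both sides
    coincide. *)
Lemma diff_feedback (R : realType) (n m : nat)
  (F : 'cV[R]_n * 'cV[R]_m -> 'cV[R]_n) (K : 'M[R]_(m, n)) v :
  differentiable F (0, 0) -> differentiable (fun x => F (x, K *m x)) 0 ->
  'd (fun x => F (x, K *m x)) 0 v = 'd F (0, 0) (v, K *m v).
Proof.
move=> dF dFK; rewrite -!deriveE // /derive.
have -> // : (fun h : R => h^-1 *: (((fun x => F (x, K *m x)) \o shift 0) (h *: v)
                              - F (0, K *m 0))) =
    (fun h : R => h^-1 *: ((F \o shift (0, 0)) (h *: (v, K *m v)) - F (0, 0))).
by apply/funext => h /=; rewrite mulmx0 !addr0 -scalemxAr.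
Qed.

Unset Implicit Arguments.

Theorem theorem6 (R : realType) (n m nu N : nat) (P : 'M[R]_nu)
  (f : 'cV[R]_n -> 'cV[R]_m -> 'I_nu -> 'cV[R]_n)
  (ell : 'cV[R]_n -> 'cV[R]_m -> 'I_nu -> R)
  (Y : 'I_nu -> set ('cV[R]_n * 'cV[R]_m)) (ell_s : R)
  (A : 'I_nu -> 'M[R]_n) (B : 'I_nu -> 'M[R]_(n, m)) (K : 'I_nu -> 'M[R]_(m, n))
  (betaf betal : 'I_nu -> R) :
  (0 < nu)%N -> (0 < N)%N ->
  (* Markov chain *)
  stochastic P -> irreducible P -> aperiodic P ->
  (* constraints, dynamics, stage cost *)
  (forall i, Y i !=set0 /\ compact (Y i)) ->
  (forall i, continuous (fun p : 'cV[R]_n * 'cV[R]_m => f p.1 p.2 i)) ->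
  (forall i, [/\ forall x u, 0 <= ell x u i,
                 lsc (fun p : 'cV[R]_n * 'cV[R]_m => ell p.1 p.2 i)
               & level_bounded_loc (fun x u => ell x u i)]) ->
  (* (0,0) is a common optimal steady state with optimal steady-state cost ell_s *)
  (forall i, f 0 0 i = 0 /\ Y i (0, 0)) ->
  (exists pi, stationary P pi /\ ell_s = \sum_i pi i * ell 0 0 i /\
     forall (xs : 'cV[R]_n) (us : 'I_nu -> 'cV[R]_m),
       (forall i, f xs (us i) i = xs /\ Y i (xs, us i)) ->
       ell_s <= \sum_i pi i * ell xs (us i) i) ->
  (* A_i, B_i are the partial Jacobians of f at (0,0,i) *)
  (forall i, differentiable (fun p : 'cV[R]_n * 'cV[R]_m => f p.1 p.2 i) (0, 0) /\
     forall v w, 'd (fun p : 'cV[R]_n * 'cV[R]_m => f p.1 p.2 i) (0, 0) (v, w)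
                 = A i *m v + B i *m w) ->
  (* the gains K_i make the MJLS with Gamma_i = A_i + B_i K_i mean square stable *)
  mjls_ms_stable P (fun i => A i + B i *m K i) ->
  (forall i, smooth_map (betaf i) (fun x => f x (K i *m x) i)) ->
  (forall i, smooth_fun (betal i) (fun x => ell x (K i *m x) i - ell 0 0 i)) ->
  ms_stabilizable P A B ->
  let fhat i x := f x (K i *m x) i in
  let lbar x i := ell x (K i *m x) i - ell 0 0 i in
  let dl0 i := 'd (fun x => lbar x i) 0 in
  exists delta alpha : R, [/\ 0 < delta, 0 < alpha,
    (* decrease condition L V_f <= - lbar on B_delta *)
    (forall x i, enorm x < delta ->
       \sum_j P i j * Vf P (fun i => A i + B i *m K i) alpha betal dl0 (fhat i x) j
       - Vf P (fun i => A i + B i *m K i) alpha betal dl0 x i <= - lbar x i)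
  & forall (Xf : 'I_nu -> set 'cV[R]_n) (kappa : 'cV[R]_n -> 'I_nu -> 'cV[R]_m)
      (lam : 'cV[R]_n -> 'I_nu -> R) (lam_s : R) (rho : 'cV[R]_n -> 'I_nu -> R)
      (gamma : R),
      UPI P f K Y Xf ->
      (forall i x, Xf i x -> enorm x < delta) ->
      (* strict stochastic dissipativity *)
      (forall i, lsc (fun x => lam x i)) ->
      (forall i, lam 0 i = lam_s) ->
      (forall i, convex_fun (fun x => rho x i)) ->
      (forall x i, 0 <= rho x i) ->
      (forall i, rho 0 i = 0 /\ forall x, x != 0 -> 0 < rho x i) ->
      (forall x u i, \sum_j P i j * lam (f x u i) j - lam x i
                     <= ell x u i - ell_s - rho x i) ->
      0 < gamma -> (forall x i, gamma * enorm x ^+ 2 <= rho x i) ->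
      (* kappa is the terminal-set EMPC law with terminal penalty V_f, terminal sets Xf *)
      empc_law N P f ell Y Xf (Vf P (fun i => A i + B i *m K i) alpha betal dl0) kappa ->
      (* local mean square stability of the closed loop on the feasible region *)
      forall x0 i0, ocp_feasible N P f Y Xf x0 i0 ->
        ms_conv P (fun x i => f x (kappa x i) i) x0 i0].
Proof.
move=> nu0 N0 sP irr _ Yc _ ellP f0 [pi [pi_st [ell_sE _]]] df stab fsm lsm _ fhat lbar dl0.
pose G i := A i + B i *m K i.
have dfhat i v : 'd (fhat i) 0 v = G i *m v.
  rewrite (@diff_feedback _ _ _ (fun p => f p.1 p.2 i)) /=; [|exact: (df i).1|exact: (fsm i).1].
  by rewrite (df i).2 mulmxDl mulmxA.
have fhat0 i : fhat i 0 = 0 by rewrite /fhat mulmx0 (f0 i).1.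
have fhat_dist i x a : `|(fhat i x - G i *m x) a 0| <= betaf i / 2 * enorm x ^+ 2.
  have : `|(fhat i x - fhat i 0 - 'd (fhat i) 0 x) a 0| <= betaf i / 2 * enorm x ^+ 2.
    exact: smooth_map_dist (fsm i).
  by rewrite fhat0 subr0 dfhat.
have lbar_le x i : lbar x i <= dl0 i x + betal i / 2 * enorm x ^+ 2.
  have := smooth_fun_upper x (lsm i).
  by rewrite mulmx0 subrr subr0.
pose D : R := \sum_i \sum_a `|dl0 i (delta_mx a 0)|.
have D_ge0 : 0 <= D by apply: sumr_ge0 => i _; exact: sumr_ge0.
have DP i z : `|dl0 i z| <= D * `|z|.
  apply: le_trans (linear_le_mx_norm (dl0 i) z) _; rewrite ler_wpM2r //.
  by rewrite /D (bigD1 i) //= lerDl; apply: sumr_ge0 => j _; exact: sumr_ge0.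
have dl0D j a b : dl0 j (a + b) = dl0 j a + dl0 j b by exact: linearD.
have [delta [alpha [delta0 alpha0 decr [M V_ge]]]] :=
  terminal_cost_decrease sP stab D_ge0 DP dl0D fhat_dist lbar_le.
exists delta, alpha; split=> // Xf kappa lam lam_s rho gamma upi Xfd lam_lsc lam0 _ _ rho0
  diss gamma0 rho_ge.
(* At the steady state the storage increment and [rho] vanish in the dissipation inequality. *)
have ell_ge_s i : ell_s <= ell 0 0 i.
  have := diss 0 0 i; rewrite (f0 i).1; under eq_bigr => j _ do rewrite lam0.
  by rewrite mean_cst // lam0 (rho0 i).1; lra.
(* The excesses over [ell_s] are nonnegative and average to 0 under [pi], whose weights are all
   positive. *)
have ell00 i : ell 0 0 i = ell_s.
  have pi_gt0 := stationary_gt0 sP irr pi_st.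
  have : \sum_i pi i * (ell 0 0 i - ell_s) = 0.
    under eq_bigr => j _ do rewrite mulrBr.
    by rewrite sumrB -ell_sE -mulr_suml; case: pi_st => _ -> _; rewrite mul1r subrr.
  move=> /eqP; rewrite psumr_eq0 => [/allP/(_ i (mem_index_enum _))/=|j _]; last first.
    by rewrite mulr_ge0 ?subr_ge0 // ltW.
  by rewrite mulf_eq0 gt_eqF //= subr_eq0 => /eqP.
case: N N0 => // N' _ kappaP x0 i0.
apply: (empc_ms_stable sP (fun i => (Yc i).2) (fun x u i => let: And3 h _ _ := ellP i in h x u)
  upi _ (fun i x Xx => V_ge x i (Xfd i x Xx)) lam_lsc diss gamma0 rho_ge kappaP).
(* With [ell 0 0 i] equal to [ell_s], the decrease condition becomes the terminal inequality with
   constant [ell_s]. *)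
move=> i x /Xfd /(decr x i); rewrite /lbar ell00 /fhat; lra.
Qed.
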